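(* Assume that $\omega$ is a (faithful normal) tracial state. Let $(X(t):t\geqslant 0)$ be a martingale in $L^2(\mathcal{A},\omega)$ and let $f\colon[0,\infty)\to\mathcal{A}$ be either monotone or norm-continuous. Then for each $t>0$ there exist integrals $$\int_0^t f\,dX=\lim_\theta S_\theta^r(f,X)\qquad\text{and}\qquad \int_0^t dX\,f=\lim_\theta S_\theta^l(f,X)$$ as elements of $L^2(\mathcal{A},\omega)$, the limits being taken in the norm $\|\cdot\|_2$ as the partition $\theta$ of $[0,t]$ is refined. Moreover, the $L^2(\mathcal{A},\omega)$-processes $(Y(t):t\geqslant0)$, $(Z(t):t\geqslant0)$ defined by $$Y(t)=\int_0^t dX\,f,\qquad Z(t)=\int_0^t f\,dX$$ (with $Y(0)=Z(0)=0$) are martingales.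
   Context: Setting. $\mathcal{A}$ is a von Neumann algebra acting in a Hilbert space $\mathcal{H}$. $\omega$ is a normal faithful state on $\mathcal{A}$ given by a unit vector $\varOmega\in\mathcal{H}$ that is cyclic and separating for $\mathcal{A}$: $\omega(x)=\langle x\varOmega,\varOmega\rangle$. A filtration is given: an increasing family $\{\mathcal{A}_t:t\in[0,+\infty)\}$ of von Neumann subalgebras of $\mathcal{A}$ ($\mathcal{A}_s\subset\mathcal{A}_t$ for $s\leqslant t$), together with a family $\{\mathbb{E}_t\}$ of normal conditional expectations $\mathbb{E}_t$ from $\mathcal{A}$ onto $\mathcal{A}_t$ leaving $\omega$ invariant ($\omega\circ\mathbb{E}_t=\omega$). The space $L^2$. $\omega$ being tracial means $\omega(xy)=\omega(yx)$ for all $x,y\in\mathcal{A}$. $L^2(\mathcal{A},\omega)$ is the completion of $\mathcal{A}$ in the norm $\|x\|_2=\omega(x^*x)^{1/2}=\|x\varOmega\|_{\mathcal{H}}$; it may be realized as a space of densely defined closed operators affiliated with $\mathcal{A}$ whose domains contain $\varOmega$. $L^2(\mathcal{A}_t,\omega)$ is the closure of $\mathcal{A}_t$ in $L^2(\mathcal{A},\omega)$. For $x\in\mathcal{A}$ and $A\in L^2(\mathcal{A},\omega)$ the products $xA$ and $Ax$ belong to $L^2(\mathcal{A},\omega)$ (they are the $\|\cdot\|_2$-continuous extensions of left and right multiplication by $x$ on $\mathcal{A}$). Each $\mathbb{E}_t$ extends to an orthogonal projection, denoted by the same letter, from $L^2(\mathcal{A},\omega)$ onto $L^2(\mathcal{A}_t,\omega)$.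 Processes. A process in $\mathcal{A}$ (respectively $L^2(\mathcal{A},\omega)$) is a function on $[0,+\infty)$ with values in that space. A process $X$ in $L^2(\mathcal{A},\omega)$ is a martingale if $\mathbb{E}_sX(t)=X(s)$ for all $0\leqslant s\leqslant t$. A process $f$ in $\mathcal{A}$ is monotone if it is increasing ($f(s)\leqslant f(t)$ for all $s\leqslant t$) or decreasing ($f(s)\geqslant f(t)$ for all $s\leqslant t$), where $a\leqslant b$ means that $b-a$ is a positive operator; it is norm-continuous if it is continuous for the operator norm. Integral sums. For a partition $\theta=\{0=t_0<t_1<\dots<t_m=t\}$ of $[0,t]$ put $$S_\theta^r(f,X)=\sum_{k=1}^m f(t_{k-1})[X(t_k)-X(t_{k-1})],\qquad S_\theta^l(f,X)=\sum_{k=1}^m [X(t_k)-X(t_{k-1})]f(t_{k-1}).$$ The partitions of $[0,t]$ form a directed set under inclusion (refinement), and $\lim_\theta$ denotes the limit of the net indexed by this directed set.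
   Formalization: The formal theorem additionally assumes that f is adapted, f(t) ∈ A_t for all t ≥ 0; without this the claim that Y and Z are martingales is false (e.g. constant f ≡ diag(1,-1) not in A_0, with X jumping to it at time 1). *)

(* Defs.v *)
From HB Require Import structures.
From mathcomp Require Import all_boot all_order all_algebra.
From mathcomp Require Import complex.
From mathcomp Require Import all_classical all_reals all_analysis.

Set Implicit Arguments.
Unset Strict Implicit.
Unset Printing Implicit Defensive.

Import Order.TTheory GRing.Theory Num.Theory.
Import numFieldNormedType.Exports.

Local Open Scope classical_set_scope.
Local Open Scope ring_scope.
Local Open Scope complex_scope.

(* Complex Hilbert spaces.  The inner product is linear in its first argument
   and conjugate-linear in the second one. *)
HB.mixin Record CompleteNormedModule_isHilbert (R : realType) (H : Type)
    of CompleteNormedModule R[i] H := {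
  dotp : {dot H for Num.Def.conjC} ;
  dotp_norm : forall x : H, `|x| ^+ 2 = dotp x x
}.

#[short(type="hilbertType")]
HB.structure Definition Hilbert (R : realType) :=
  {H of CompleteNormedModule_isHilbert R H & CompleteNormedModule R[i] H}.

Section Operators.
Context {R : realType} {H : hilbertType R}.
Implicit Types (x y z : H -> H) (A B D S : set (H -> H)) (E : (H -> H) -> H -> H).

Definition bounded_op x := linear x /\ continuous x.

Definition opnorm x : R :=
  sup [set complex.Re `|x xi| | xi in [set xi : H | `|xi| <= 1]].

Definition adjoint_of x y := forall xi eta, dotp (x xi) eta = dotp xi (y eta).

(* Over the complex scalars, 0 <= c also says that c is real, so that positive
   operators are self-adjoint. *)
Definition op_ge0 x := forall xi, 0 <= dotp (x xi) xi.
Definition op_le x y := op_ge0 (y - x).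

Definition commutant S : set (H -> H) :=
  [set x | bounded_op x /\ forall y, S y -> x \o y = y \o x].

(* Being a unital subalgebra is a consequence of von_neumann_bicommutant. *)
Record von_neumann A : Prop := {
  von_neumann_bounded : forall x, A x -> bounded_op x ;
  von_neumann_star : forall x, A x -> exists2 y, A y & adjoint_of x y ;
  von_neumann_bicommutant : commutant (commutant A) = A
}.

Definition cyclic_vector A (Omega : H) := dense [set x Omega | x in A].

Definition separating_vector A (Omega : H) :=
  forall x, A x -> x Omega = 0 -> x = 0.

Definition vector_state (Omega : H) x : R[i] := dotp (x Omega) Omega.

Definition norm2 (Omega : H) x : R[i] := `|x Omega|.

Definition tracial A (Omega : H) := forall x y, A x -> A y ->
  vector_state Omega (x \o y) = vector_state Omega (y \o x).

(* Only the values of E on A are relevant. *)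
Record conditional_expectation A B E : Prop := {
  cond_exp_in : forall x, A x -> B (E x) ;
  cond_exp_id : forall y, B y -> E y = y ;
  cond_exp_linear : forall (c : R[i]) x y, A x -> A y ->
    E (c *: x + y) = c *: E x + E y ;
  cond_exp_ge0 : forall x, A x -> op_ge0 x -> op_ge0 (E x) ;
  cond_exp_bimodule : forall y x z, B y -> A x -> B z ->
    E (y \o x \o z) = y \o E x \o z
}.

Definition op_lub A D x := [/\ A x,
  forall d, D d -> op_le d x &
  forall y, A y -> (forall d, D d -> op_le d y) -> op_le x y].

Definition op_directed D := D !=set0 /\
  forall x y, D x -> D y -> exists z, [/\ D z, op_le x z & op_le y z].

(* Normality, with bounded increasing nets of positive operators given by their
   ranges: a directed set has a least upper bound iff it is bounded above. *)
Definition normal_map A B E := forall D x,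
  D `<=` A -> (forall d, D d -> op_ge0 d) -> op_directed D ->
  op_lub A D x -> op_lub B (E @` D) (E x).

Definition state_invariant A (Omega : H) E := forall x, A x ->
  vector_state Omega (E x) = vector_state Omega x.

Record filtration A (At : R -> set (H -> H)) : Prop := {
  filtration_von_neumann : forall t, 0 <= t -> von_neumann (At t) ;
  filtration_sub : forall t, 0 <= t -> At t `<=` A ;
  filtration_increasing : forall s t, 0 <= s -> s <= t -> At s `<=` At t
}.

Definition adapted (At : R -> set (H -> H)) (f : R -> H -> H) :=
  forall t, 0 <= t -> At t (f t).

Definition monotone_process (f : R -> H -> H) :=
  (forall s t, 0 <= s -> s <= t -> op_le (f s) (f t)) \/
  (forall s t, 0 <= s -> s <= t -> op_le (f t) (f s)).

Definition opnorm_continuous (f : R -> H -> H) := forall t, 0 <= t ->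
  opnorm (f s - f t) @[s --> within [set s | 0 <= s] (nbhs t)] --> (0 : R).

(* iota : A -> L2 exhibits L2 as the completion of A for norm2. *)
Record completion2 A (Omega : H) (L2 : completeNormedModType R[i])
    (iota : (H -> H) -> L2) : Prop := {
  completion2_linear : forall (c : R[i]) x y, A x -> A y ->
    iota (c *: x + y) = c *: iota x + iota y ;
  completion2_norm : forall x, A x -> `|iota x| = norm2 Omega x ;
  completion2_dense : dense (iota @` A)
}.

End Operators.

(* The pointed partitions 0 = t_0 < t_1 < ... < t_m = t are represented by
   [:: t_1; ...; t_m].  The sets of all refinements of a given partition form
   the base of a filter, along which limits are the limits of nets indexed by
   the partitions of [0, t] ordered by inclusion. *)
Definition refinements {R : realType} (t : R) : set_system (seq R) :=
  filter_from [set s0 | itv_partition 0 t s0]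
    (fun s0 => [set s | itv_partition 0 t s /\ {subset s0 <= s}]).

Section Integral.
Context {R : realType} {H : hilbertType R}.
Variables (A : set (H -> H)) (L2 : completeNormedModType R[i]).
Variable iota : (H -> H) -> L2.

(* The continuous extension to L2 of a transformation T of A; it is unique since
   iota @` A is dense.  The value cst 0 is taken only if there is none. *)
Definition extend2 (T : (H -> H) -> H -> H) : L2 -> L2 :=
  xget (cst 0) [set g | continuous g /\
                        forall y, A y -> g (iota y) = iota (T y)].

Definition lmul2 (x : H -> H) : L2 -> L2 := extend2 (fun y => x \o y).
Definition rmul2 (x : H -> H) : L2 -> L2 := extend2 (fun y => y \o x).

Definition martingale (E : R -> (H -> H) -> H -> H) (X : R -> L2) :=
  forall s t, 0 <= s -> s <= t -> extend2 (E s) (X t) = X s.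

Definition sum_fdX (f : R -> H -> H) (X : R -> L2) (s : seq R) : L2 :=
  let t := nth 0 (0 :: s) in
  \sum_(0 <= k < size s) lmul2 (f (t k)) (X (t k.+1) - X (t k)).

Definition sum_dXf (f : R -> H -> H) (X : R -> L2) (s : seq R) : L2 :=
  let t := nth 0 (0 :: s) in
  \sum_(0 <= k < size s) rmul2 (f (t k)) (X (t k.+1) - X (t k)).

Definition integral_fdX (f : R -> H -> H) (X : R -> L2) (t : R) : L2 :=
  if t == 0 then 0 else lim (sum_fdX f X s @[s --> refinements t]).

Definition integral_dXf (f : R -> H -> H) (X : R -> L2) (t : R) : L2 :=
  if t == 0 then 0 else lim (sum_dXf f X s @[s --> refinements t]).

End Integral.

(* Main.v *)
(** In L2 the extended conditional expectations are commuting orthogonal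
    projections, and left (by traciality also right) multiplication by an
    element of the algebra at time p commutes with all later projections.  Hence
    the terms of an integral sum are pairwise orthogonal, and if w refines s then
    S_w - S_s is the sum over w of (f(p) - f(c)) dX, c being the last point of s
    before p, so that its squared norm is the sum of the squared norms of the terms.
    For continuous f a fine partition s makes f(p) - f(c) small.  For increasing f,
    g = f(p) - f(c) satisfies 0 <= g <= C, so |g x|^2 <= C <g x, x>; summing,
    |S_w - S_s|^2 <= C (Phi(w) - Phi(s)) for the energy
    Phi(s) = sum <(f - f(0)) dX, dX>, which is bounded and increases under
    refinement.  The martingale property passes to the limit from
    P_s S_w = S_(w up to s), for partitions w containing s. *)
Require Import Defs.
From HB Require Import structures.
From mathcomp Require Import all_boot all_order all_algebra.
From mathcomp Require Import complex ring lra.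
From mathcomp Require Import all_classical all_reals all_analysis.

Set Implicit Arguments.
Unset Strict Implicit.
Unset Printing Implicit Defensive.

Import Order.TTheory GRing.Theory Num.Theory.
Import numFieldNormedType.Exports.

Local Open Scope classical_set_scope.
Local Open Scope ring_scope.
Local Open Scope complex_scope.

(** * Partitions of an interval and sums over their cells *)

Section Partitions.
Context {R : realType}.
Implicit Types (a b c p q t : R) (s w : seq R).

Lemma path_gt a s x : path <%R a s -> x \in s -> a < x.
Proof. by rewrite lt_path_sortedE => /andP[/allP + _] => /[apply]. Qed.

Lemma path_le_last a s x : path <%R a s -> x \in a :: s -> x <= last a s.
Proof.
elim: s a x => [|b s IH] a x /=; first by rewrite inE => _ /eqP->.
move=> /andP[ab pbs]; rewrite inE => /orP[/eqP->|]; last exact: IH.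
by apply: le_trans (ltW ab) (IH _ _ pbs _); rewrite mem_head.
Qed.

Lemma itv_partitionP t s : 0 < t -> itv_partition 0 t s <->
  [/\ sorted <%R s, forall x, x \in s -> 0 < x <= t & t \in s].
Proof.
move=> t0; split=> [[p0s /eqP lst]|[ss s0t ts]].
  split; first exact: path_sorted p0s.
    move=> x xs; rewrite (path_gt p0s xs) -lst.
    by rewrite (path_le_last p0s)// inE xs orbT.
  have := mem_last 0 s; rewrite lst inE => /orP[/eqP t00|//].
  by move: t0; rewrite t00 ltxx.
have p0s : path <%R 0 s.
  by rewrite lt_path_sortedE ss andbT; apply/allP => x /s0t/andP[].
split=> //; rewrite eq_le (path_le_last p0s) ?inE ?ts ?orbT// andbT.
have := mem_last 0 s; rewrite inE => /orP[/eqP->|/s0t/andP[]//].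
exact: ltW.
Qed.

Lemma common_refinement t s w : 0 < t -> itv_partition 0 t s ->
  {in w, forall x, 0 < x <= t} ->
  exists r, [/\ itv_partition 0 t r, {subset s <= r} & {subset w <= r}].
Proof.
move=> t0 /(itv_partitionP _ t0)[ss s0t ts] w0t.
exists (sort <=%R (undup (s ++ w))); split.
- apply/itv_partitionP => //; split.
  + by rewrite sort_lt_sorted undup_uniq.
  + by move=> x; rewrite mem_sort mem_undup mem_cat => /orP[/s0t|/w0t].
  + by rewrite mem_sort mem_undup mem_cat ts.
- by move=> x xs; rewrite mem_sort mem_undup mem_cat xs.
- by move=> x xs; rewrite mem_sort mem_undup mem_cat xs orbT.
Qed.

Lemma refinements_filter t : 0 < t -> ProperFilter (refinements t).
Proof.
move=> t0; apply: filter_from_proper; last first.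
  by move=> s [p0s st]; exists s; split.
apply: filter_from_filter.
  by exists [:: t]; split=> //=; rewrite t0.
move=> s w ps pw; have /(itv_partitionP _ t0)[_ w0t _] := pw.
have [r [pr sr wr]] := common_refinement t0 ps w0t.
exists r => //= z [pz rz]; split; split=> // x.
  by move=> /sr/rz.
by move=> /wr/rz.
Qed.

(** The left end [a] is an argument, so that sums unfold cell by cell and split at concatenations;
    [psum_nth] identifies them with the indexed sums of the integrals. *)
Fixpoint psum {W : zmodType} (G : R -> R -> W) a s : W :=
  if s is b :: s' then G a b + psum G b s' else 0.

Lemma psum_nth {W : zmodType} (G : R -> R -> W) a s :
  psum G a s = \sum_(0 <= k < size s) G (nth 0 (a :: s) k) (nth 0 (a :: s) k.+1).
Proof.
elim: s a => [|b s IH] a /=; first by rewrite big_nil.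
by rewrite big_nat_recl// IH.
Qed.

Lemma psum_cat {W : zmodType} (G : R -> R -> W) a s w :
  psum G a (s ++ w) = psum G a s + psum G (last a s) w.
Proof. by elim: s a => [|b s IH] a /=; rewrite ?add0r// IH addrA. Qed.

(** One induction for all that passes from cells to sums: [rel] will be an equality, an inequality
    up to a factor, or a statement about the image under a projection. *)
Lemma psum_rel {W W' : zmodType} (rel : W -> W' -> Prop) G G' a s :
  rel 0 0 -> (forall x y x' y', rel x y -> rel x' y' -> rel (x + x') (y + y')) ->
  path <%R a s ->
  (forall p q, a <= p -> p < q -> q <= last a s -> rel (G p q) (G' p q)) ->
  rel (psum G a s) (psum G' a s).
Proof.
move=> rel0 relD; elim: s a => [//|b s IH] a /= /andP[ab pbs] relG.
apply: relD; first by apply: relG => //; apply: path_le_last; rewrite ?mem_head.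
by apply: IH => // p q bp; apply: relG; apply: le_trans bp; exact: ltW.
Qed.

Lemma eq_psum {W : zmodType} (G G' : R -> R -> W) a s : path <%R a s ->
  (forall p q, a <= p -> p < q -> q <= last a s -> G p q = G' p q) ->
  psum G a s = psum G' a s.
Proof. by apply: psum_rel => // x y x' y' -> ->. Qed.

Lemma psumB {W : zmodType} (G G' : R -> R -> W) a s :
  psum G a s - psum G' a s = psum (fun p q => G p q - G' p q) a s.
Proof.
elim: s a => [|b s IH] a /=; first by rewrite subrr.
by rewrite -IH opprD addrACA.
Qed.

Lemma psumN {W : zmodType} (G : R -> R -> W) a s :
  psum (fun p q => - G p q) a s = - psum G a s.
Proof. by elim: s a => [|b s IH] a /=; rewrite ?oppr0// IH opprD. Qed.

Lemma psum_telescope {W : zmodType} (G : R -> R -> W) a s : path <%R a s ->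
  (forall p, G p p = 0) ->
  (forall p q r, a <= p -> p < q -> q <= r -> G p q + G q r = G p r) ->
  psum G a s = G a (last a s).
Proof.
move=> + G0; elim: s a => [|b s IH] a /=; first by rewrite G0.
move=> /andP[ab pbs] GD; rewrite IH//.
  by apply: GD => //; apply: path_le_last; rewrite ?mem_head.
by move=> p q r bp; apply: GD; apply: le_trans bp; exact: ltW.
Qed.

(** The left end of the cell of [s] that contains [p]; the default [a] serves the first cell. *)
Definition partition_floor a s p : R := last a [seq x <- s | x <= p].

Lemma partition_floor_ge a s p : path <%R a s -> a <= partition_floor a s p.
Proof.
move=> pas; rewrite /partition_floor.
have := mem_last a [seq x <- s | x <= p]; rewrite inE => /orP[/eqP->//|].
by rewrite mem_filter => /andP[_ /(path_gt pas)/ltW].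
Qed.

Lemma partition_floor_le a s p : a <= p -> partition_floor a s p <= p.
Proof.
move=> ap; rewrite /partition_floor.
have := mem_last a [seq x <- s | x <= p]; rewrite inE => /orP[/eqP->//|].
by rewrite mem_filter => /andP[].
Qed.

(** The first argument of [G] is the time at which the integrand is frozen. Between consecutive
    points of [s] the floor is constant, so the corresponding block of [w] telescopes by
    additivity. *)
Lemma psum_refine {W : zmodType} (G : R -> R -> R -> W) a s w :
  (forall c p, a <= c -> G c p p = 0) ->
  (forall c p q r, a <= c -> c <= p -> p < q -> q <= r ->
     G c p q + G c q r = G c p r) ->
  path <%R a s -> path <%R a w -> last a s = last a w -> {subset s <= w} ->
  psum (fun p q => G (partition_floor a s p) p q) a w =
  psum (fun p q => G p p q) a s.
Proof.
elim: s a w => [|b s IH] a w G0 GD /=.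
  move=> _; case: w => [//|b w] /= /andP[ab pbw] ab'; exfalso.
  have := path_le_last pbw (mem_head _ _); rewrite -ab'.
  by rewrite leNgt ab.
move=> /andP[ab pbs] paw lsw sw.
have bw : b \in w by apply: sw; rewrite mem_head.
(* Cut [w] at the first point [b] of [s]: on the first block the floor is [a], and the second block
   is left to the induction hypothesis. *)
case/splitPr: w / bw => w1 w2 in paw lsw sw *.
move: paw lsw; rewrite -cat_rcons cat_path last_cat last_rcons.
move=> /andP[paw1 pbw2] lsw; rewrite psum_cat last_rcons; congr (_ + _).
  rewrite [RHS](_ : _ = G a a (last a (rcons w1 b))) ?last_rcons//.
  rewrite -[in RHS](last_rcons a w1 b).
  rewrite -(psum_telescope (G := G a) paw1)//.
    apply: eq_psum => // p q ap pq qb; congr (G _ p q).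
    rewrite last_rcons in qb.
    have pb : p < b by exact: lt_le_trans qb.
    rewrite /partition_floor/= leNgt pb/=.
    rewrite (_ : [seq _ <- _ | _] = [::])//.
    apply/eqP; rewrite -[_ == _]negbK -has_filter; apply/hasPn => x xs.
    by rewrite -ltNge (lt_trans pb)// (path_gt pbs).
  - by move=> p; apply: G0.
  - by move=> p q r ap; apply: GD.
rewrite -(IH b w2)//.
- apply: eq_psum => // p q bp pq _.
  by rewrite /partition_floor/= bp.
- by move=> c p bc; apply: G0; apply: le_trans bc; exact: ltW.
- by move=> c p q r bc; apply: GD; apply: le_trans bc; exact: ltW.
(* Later points of [s] exceed [b], so they can only lie in the second block. *)
- move=> x xs; have := sw x; rewrite inE xs orbT => /(_ isT).
  rewrite -cat_rcons mem_cat => /orP[|//] xw1.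
  have := path_le_last paw1; rewrite last_rcons => /(_ x).
  rewrite inE xw1 orbT => /(_ isT); rewrite leNgt.
  by rewrite (path_gt pbs xs).
Qed.

End Partitions.

(** * Identities for functions with a proof of linearity *)

Section LinearFunctions.
Context {K : pzRingType} {V W : lmodType K} (g : V -> W) (glin : linear g).

Lemma linearB_fun x y : g (x - y) = g x - g y.
Proof. by rewrite addrC -scaleN1r glin scaleN1r addrC. Qed.

Lemma linear0_fun : g 0 = 0.
Proof. by rewrite -(subrr 0) linearB_fun !subrr. Qed.

Lemma linearD_fun x y : g (x + y) = g x + g y.
Proof. by rewrite -[x in g (x + _)]scale1r glin scale1r. Qed.

Lemma linearZ_fun c x : g (c *: x) = c *: g x.
Proof. by rewrite -[c *: x]addr0 glin linear0_fun addr0. Qed.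

End LinearFunctions.

(** * Inner products that induce a given norm *)

Section InnerProducts.
Context {R : realType} {V : normedModType R[i]}.
Implicit Types (x y z : V) (c : R[i]).
Local Notation K := (R[i] : numFieldType).

Record inner_product (d : V -> V -> R[i]) : Prop := {
  ip_linear : forall c x y z, d (c *: x + y) z = c * d x z + d y z ;
  ip_conj : forall x y, Num.conj (d y x) = d x y ;
  ip_norm : forall x, `|x| ^+ 2 = d x x
}.

Variables (d : V -> V -> R[i]) (dP : inner_product d).

Lemma ip0l y : d 0 y = 0.
Proof.
have := ip_linear dP 1 0 0 y; rewrite scaler0 addr0 mul1r => /eqP.
by rewrite -subr_eq0 opprD addNKr oppr_eq0 => /eqP.
Qed.

Lemma ipDl x y z : d (x + y) z = d x z + d y z.
Proof. by rewrite -[x in d (x + _)]scale1r (ip_linear dP) mul1r. Qed.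

Lemma ipZl c x z : d (c *: x) z = c * d x z.
Proof. by rewrite -[c *: x]addr0 (ip_linear dP) ip0l addr0. Qed.

Lemma ipNl x z : d (- x) z = - d x z.
Proof. by rewrite -scaleN1r ipZl mulN1r. Qed.

Lemma ipBl x y z : d (x - y) z = d x z - d y z.
Proof. by rewrite ipDl ipNl. Qed.

Lemma ip0r x : d x 0 = 0.
Proof. by rewrite -(ip_conj dP) ip0l rmorph0. Qed.

Lemma ipDr x y z : d x (y + z) = d x y + d x z.
Proof. by rewrite -!(ip_conj dP x) ipDl rmorphD. Qed.

Lemma ipZr c x z : d x (c *: z) = Num.conj c * d x z.
Proof. by rewrite -!(ip_conj dP x) ipZl rmorphM. Qed.

Lemma ipNr x z : d x (- z) = - d x z.
Proof. by rewrite -!(ip_conj dP x) ipNl rmorphN. Qed.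

Lemma ipBr x y z : d x (y - z) = d x y - d x z.
Proof. by rewrite ipDr ipNr. Qed.

Lemma ip_ge0 x : 0 <= d x x.
Proof. by rewrite -(ip_norm dP) exprn_ge0. Qed.

Lemma ip_eq0 x : (d x x == 0) = (x == 0).
Proof. by rewrite -(ip_norm dP) sqrf_eq0 normr_eq0. Qed.

Lemma ip_injl x y : (forall z, d x z = d y z) -> x = y.
Proof.
by move=> dxy; apply/eqP; rewrite -subr_eq0 -ip_eq0 ipBl dxy subrr.
Qed.

Lemma ip_pythagoras x y : d x y = 0 -> `|x + y| ^+ 2 = `|x| ^+ 2 + `|y| ^+ 2.
Proof.
move=> dxy; have dyx : d y x = 0 by rewrite -(ip_conj dP) dxy rmorph0.
by rewrite !(ip_norm dP) ipDl !ipDr dxy dyx addr0 add0r.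
Qed.

Lemma cauchy_schwarz x y : `|d x y| <= `|x| * `|y|.
Proof.
have [->|y0] := eqVneq y 0; first by rewrite ip0r !normr0 mulr0.
have dyy : 0 < d y y by rewrite lt_neqAle eq_sym ip_eq0 y0 ip_ge0.
rewrite -ler_sqr ?nnegrE ?mulr_ge0// exprMn !(ip_norm dP).
(* This vector is [d y y] times the component of [x] orthogonal to [y], which avoids a division. *)
have := ip_ge0 (d y y *: x - d x y *: y).
rewrite ipBl !ipBr !ipZl !ipZr.
rewrite (geC0_conj (ip_ge0 y)) (ip_conj dP) normCK (ip_conj dP).
set p := d x y; set q := d y x; set u := d x x; set v := d y y.
rewrite (_ : _ - _ = v * (u * v - p * q)); last by ring.
by rewrite pmulr_rge0// subr_ge0.
Qed.

(** By polarization the form is a combination of squared norms. *)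
Lemma ip_continuous (T : topologicalType) (g h : T -> V) :
  continuous g -> continuous h -> continuous (fun a => d (g a) (h a) : K).
Proof.
move=> gc hc a.
pose i := 'i%R : R[i].
have polar x y : d x y = 4^-1 * (`|x + y| ^+ 2 - `|x - y| ^+ 2 +
    i * `|x + i *: y| ^+ 2 - i * `|x - i *: y| ^+ 2).
  rewrite !(ip_norm dP) !(ipDl, ipDr, ipNl, ipNr, ipZl, ipZr) conjCi -/i.
  have i2 : i * i = -1 by rewrite -expr2 sqrCi.
  clearbody i.  apply: (@mulfI _ 4); first by rewrite pnatr_eq0.
  rewrite mulrA divff ?mul1r ?pnatr_eq0//; ring : i2.
rewrite /continuous_at polar; under eq_fun do rewrite polar.
have sq (u : T -> V) : u x @[x --> a] --> u a ->
    (`|u x| ^+ 2 : K) @[x --> a] --> (`|u a| ^+ 2 : K).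
  by move=> uc; rewrite !expr2; under eq_fun do rewrite expr2;
    apply: cvgM; exact: cvg_norm.
apply: cvgM; first exact: cvg_cst.
have gca := gc a; have hca := hc a.
have ihca : i *: h x @[x --> a] --> i *: h a by apply: cvgZr.
apply: cvgB.
  apply: cvgD; last by apply: cvgM; [exact: cvg_cst|apply: sq; exact: cvgD].
  by apply: cvgB; apply: sq; [exact: cvgD|exact: cvgB].
by apply: cvgM; [exact: cvg_cst|apply: sq; exact: cvgB].
Qed.

(** The defect of symmetry [b] is sesquilinear and vanishes on the diagonal. Its values at [y + x]
    and at [i *: y + x] give two equations that force [b x y = 0]. *)
Lemma positive_symmetric (g : V -> V) : linear g ->
  (forall x, 0 <= d (g x) x) -> forall x y, d (g x) y = d x (g y).
Proof.
move=> glin g0 x y.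
pose b u v := d (g u) v - d u (g v).
have bxx u : b u u = 0.
  by rewrite /b -(ip_conj dP u) (geC0_conj (g0 u)) subrr.
pose i := 'i%R : R[i].
have gL c u v : g (c *: u + v) = c *: g u + g v by exact: glin.
have e1 := bxx (1 *: y + x); have e2 := bxx (i *: y + x).
apply/eqP; rewrite -subr_eq0; apply/eqP.
have {e1} : b x y + b y x = 0.
  rewrite -e1 /b !gL !scale1r !(ipDl, ipDr).
  by move: (bxx x) (bxx y) => /subr0_eq-> /subr0_eq->; rewrite /b; ring.
have {e2} : i * b y x - i * b x y = 0.
  rewrite -e2 /b !gL !(ipDl, ipDr, ipZl, ipZr) conjCi.
  move: (bxx x) (bxx y) => /subr0_eq-> /subr0_eq->; rewrite /b -/i; ring.
rewrite /i => /eqP; rewrite -mulrBr mulf_eq0 (negPf (neq0Ci _))/= subr_eq0 => /eqP->.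
by move=> /eqP; rewrite -mulr2n mulrn_eq0/= => /eqP.
Qed.

(* Expand [0 <= d (g z) z] at [z = x - C^-1 *: g x]: no square root of [g] is
   needed. *)
Lemma positive_norm_le (g : V -> V) C : linear g -> 0 < C ->
  (forall x, 0 <= d (g x) x) -> (forall x, d (g x) x <= C * `|x| ^+ 2) ->
  forall x, `|g x| ^+ 2 <= C * d (g x) x.
Proof.
move=> glin C0 g0 gC x.
have gsym := positive_symmetric glin g0.
have gL c u v : g (c *: u + v) = c *: g u + g v by exact: glin.
have := g0 (- C *: x + g x); have := gC (g x).
rewrite gL !(ipDl, ipDr, ipZl, ipZr) rmorphN/= (geC0_conj (ltW C0)).
rewrite (gsym (g x) x) (ip_norm dP).
set u := d (g x) (g x); set v := d (g x) x => guC.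
move=> h; have {}h : 0 <= C * (C * v - u).
  apply: (le_trans h); rewrite -subr_ge0.
  rewrite (_ : _ - _ = C * u - d (g (g x)) (g x)) ?subr_ge0//; ring.
by rewrite -subr_ge0 -(pmulr_rge0 _ C0).
Qed.

End InnerProducts.

(** * Transformed martingale increments in an abstract space with projections *)

Section MartingaleTransforms.
Context {R : realType} {V : completeNormedModType R[i]}.
Variables (d : V -> V -> R[i]) (dP : inner_product d).
Variable P : R -> V -> V.
Hypothesis P_linear : forall t, 0 <= t -> linear (P t).
Hypothesis P_contraction : forall t, 0 <= t -> forall x, `|P t x| <= `|x|.
Hypothesis P_symmetric : forall t, 0 <= t ->
  forall x y, d (P t x) y = d x (P t y).
Hypothesis P_tower : forall s t, 0 <= s -> s <= t ->
  forall x, P s (P t x) = P s x.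
Hypothesis P_id : forall s t, 0 <= s -> s <= t ->
  forall x, P t (P s x) = P s x.
Variable X : R -> V.
Hypothesis X_martingale : forall s t, 0 <= s -> s <= t -> P s (X t) = X s.

(** Abstracts multiplication by an element of the algebra at time [p]. *)
Definition commutes_after (p : R) (K : V -> V) :=
  linear K /\ forall u x, p <= u -> P u (K x) = K (P u x).

Lemma commutes_afterW p q K : p <= q -> commutes_after p K -> commutes_after q K.
Proof.
by move=> pq [Klin Kcomm]; split=> // u x qu; apply/Kcomm/(le_trans pq).
Qed.

Lemma commutes_afterB p K L : 0 <= p -> commutes_after p K ->
  commutes_after p L -> commutes_after p (fun x => K x - L x).
Proof.
move=> p0 [Klin Kcomm] [Llin Lcomm]; split=> [c x y|u x pu].
  by rewrite Klin Llin scalerBr opprD addrACA.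
by rewrite (linearB_fun (P_linear (le_trans p0 pu))) Kcomm ?Lcomm.
Qed.

Lemma commutes_afterN p K : 0 <= p -> commutes_after p K ->
  commutes_after p (fun x => - K x).
Proof.
move=> p0 [Klin Kcomm]; split=> [c x y|u x pu].
  by rewrite Klin scalerN opprD.
rewrite -[- K x]add0r (linearB_fun (P_linear (le_trans p0 pu))).
by rewrite linear0_fun ?sub0r ?Kcomm//; apply: P_linear (le_trans p0 pu).
Qed.

(** Both ends of the increment lie in the range of [P b], which commutes with [K]. *)
Lemma increment_future p q b K : 0 <= p -> p <= q -> q <= b ->
  commutes_after p K -> P b (K (X q - X p)) = K (X q - X p).
Proof.
move=> p0 pq qb [Klin Kcomm]; have q0 := le_trans p0 pq.
have pb := le_trans pq qb.
rewrite Kcomm ?(le_trans pq)//; congr K.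
rewrite (linearB_fun (P_linear (le_trans q0 qb))).
rewrite -(X_martingale q0 (lexx q)) P_id//.
by rewrite -(X_martingale p0 (lexx p)) P_id.
Qed.

(** Project first to time [p], where [K] commutes and the increment projects to 0. *)
Lemma increment_past p q a K : 0 <= a -> a <= p -> p <= q ->
  commutes_after p K -> P a (K (X q - X p)) = 0.
Proof.
move=> a0 ap pq [Klin Kcomm]; have p0 := le_trans a0 ap.
rewrite -(P_tower a0 ap) Kcomm// (linearB_fun (P_linear p0)).
rewrite !X_martingale// subrr (linear0_fun Klin) linear0_fun//.
exact: P_linear.
Qed.

Lemma psum_future K b s : (forall p, 0 <= p -> commutes_after p (K p)) ->
  path <%R 0 s -> last 0 s <= b ->
  P b (psum (fun p q => K p (X q - X p)) 0 s) =
  psum (fun p q => K p (X q - X p)) 0 s.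
Proof.
move=> Kcomm p0s sb.
have b0 : 0 <= b by apply: le_trans sb; rewrite path_le_last ?mem_head.
apply: (psum_rel (rel := fun x y => P b x = y) _ _ p0s).
- by rewrite linear0_fun//; exact: P_linear.
- by move=> x y x' y' <- <-; rewrite linearD_fun//; exact: P_linear.
move=> p q p0 pq qs; apply: increment_future => //; first exact: ltW.
  exact: le_trans sb.
exact: Kcomm.
Qed.

Lemma psum_past K a b s : (forall p, 0 <= p -> commutes_after p (K p)) ->
  0 <= a -> a <= b -> path <%R b s ->
  P a (psum (fun p q => K p (X q - X p)) b s) = 0.
Proof.
move=> Kcomm a0 ab pbs.
apply: (psum_rel (rel := fun x (y : R) => P a x = 0) (G' := fun _ _ => 0)
         _ _ pbs).
- by rewrite linear0_fun//; exact: P_linear.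
- move=> x y x' y' Px Px'; rewrite linearD_fun ?Px ?Px' ?addr0//.
  exact: P_linear.
move=> p q bp pq _; apply: increment_past => //; first exact: le_trans bp.
  exact: ltW.
by apply: Kcomm; apply: le_trans bp; exact: le_trans ab.
Qed.

(** The first term is fixed by the symmetric projection [P b], which annihilates the rest of the
    sum; so the two are orthogonal. *)
Lemma psum_orthogonal K a s : (forall p, 0 <= p -> commutes_after p (K p)) ->
  0 <= a -> path <%R a s ->
  `|psum (fun p q => K p (X q - X p)) a s| ^+ 2 =
  psum (fun p q => `|K p (X q - X p)| ^+ 2) a s.
Proof.
move=> Kcomm; elim: s a => [|b s IH] a a0 /=; first by rewrite normr0 expr0n.
move=> /andP[ab pbs]; have b0 := le_trans a0 (ltW ab).
rewrite (ip_pythagoras dP) ?IH//.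
rewrite -(increment_future (b := b) a0 (ltW ab) (lexx _) (Kcomm a a0)).
by rewrite P_symmetric// psum_past// (ip0r dP).
Qed.

(** Orthogonality for the identity operators, whose sum telescopes. This yields bounds that do not
    depend on the partition. *)
Lemma psum_increments t s : itv_partition 0 t s ->
  psum (fun p q => `|X q - X p| ^+ 2) 0 s = `|X t - X 0| ^+ 2.
Proof.
move=> [p0s /eqP lst].
have idcomm p : 0 <= p -> commutes_after p id by move=> p0; split.
rewrite -(@psum_orthogonal (fun=> id))// -lst.
rewrite (psum_telescope (G := fun p q => X q - X p))//.
  by move=> p; rewrite subrr.
by move=> p q r _ _ _; rewrite addrC subrKA.
Qed.

(** In both cross terms one factor is fixed by [P q] and the other is annihilated by it. Hence the
    energy can be regrouped along a refinement. *)
Lemma quadratic_increment_additive K p q r : 0 <= p -> p <= q -> q <= r ->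
  commutes_after p K ->
  d (K (X q - X p)) (X q - X p) + d (K (X r - X q)) (X r - X q) =
  d (K (X r - X p)) (X r - X p).
Proof.
move=> p0 pq qr Kp; have q0 := le_trans p0 pq.
have Kq := commutes_afterW pq Kp.
have idp : commutes_after p id by split.
have [Klin _] := Kp.
have uv : d (K (X q - X p)) (X r - X q) = 0.
  rewrite -(increment_future p0 pq (lexx q) Kp) P_symmetric//.
  by rewrite (increment_past q0 (lexx q) qr (commutes_afterW pq idp)) (ip0r dP).
have vu : d (K (X r - X q)) (X q - X p) = 0.
  rewrite -(increment_future p0 pq (lexx q) idp) -P_symmetric//.
  by rewrite (increment_past q0 (lexx q) qr Kq) (ip0l dP).
have -> : X r - X p = (X q - X p) + (X r - X q) by rewrite [RHS]addrC subrKA.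
move: (X q - X p) (X r - X q) uv vu => u v uv vu.
by rewrite (linearD_fun Klin) !(ipDl dP) !(ipDr dP) uv vu addr0 add0r.
Qed.

(** * Convergence of the sums for an adapted family of operators *)

Variable F : R -> V -> V.
Hypothesis F_adapted : forall p, 0 <= p -> commutes_after p (F p).

Let S s := psum (fun p q => F p (X q - X p)) 0 s.

(** Regrouped along [w], the coarse sum uses the operator at the floor of [p]. The difference of the
    two operators still commutes with the projections after [p], so orthogonality applies. *)
Lemma psum_refinementB t s w : itv_partition 0 t s -> itv_partition 0 t w ->
  {subset s <= w} ->
  `|S w - S s| ^+ 2 = psum (fun p q =>
     `|F p (X q - X p) - F (partition_floor 0 s p) (X q - X p)| ^+ 2) 0 w.
Proof.
move=> [p0s /eqP lst] [p0w /eqP lwt] sw.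
have fl0 p : 0 <= partition_floor 0 s p by exact: partition_floor_ge.
rewrite /S -(psum_refine (G := fun c p q => F c (X q - X p)) _ _ p0s p0w)//.
- rewrite psumB -(@psum_orthogonal
    (fun p x => F p x - F (partition_floor 0 s p) x))//.
  move=> p p0; apply: commutes_afterB => //; first exact: F_adapted.
  apply: commutes_afterW (F_adapted (fl0 p)).
  exact: partition_floor_le.
- by move=> c p c0; rewrite subrr linear0_fun//; have [] := F_adapted c0.
- move=> c p q r c0 _ _ _; have [Flin _] := F_adapted c0.
  by rewrite -(linearD_fun Flin) addrC subrKA.
- by rewrite lst.
Qed.

Lemma refinements_cauchy_cvg (T : seq R -> V) t : 0 < t ->
  (forall e : R[i], 0 < e -> exists2 s, itv_partition 0 t s &
     forall w, itv_partition 0 t w -> {subset s <= w} ->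
       `|T w - T s| ^+ 2 < e) ->
  cvg (T s @[s --> refinements t]).
Proof.
move=> t0 Tcauchy; have FF := refinements_filter t0.
apply: cauchy_cvg; apply: cauchy_exP => e e0.
have [s ps Ts] := Tcauchy _ (exprn_gt0 2 e0).
exists (T s); exists s => // w [pw sw] /=.
rewrite -ball_normE /= distrC -(@ltr_pXn2r _ 2) ?nnegrE// ?(ltW e0)//.
exact: Ts.
Qed.

Lemma refinements_lim (T : seq R -> V) t : 0 < t ->
  cvg (T s @[s --> refinements t]) -> forall e : R[i], 0 < e ->
  exists2 s, itv_partition 0 t s & forall w, itv_partition 0 t w ->
    {subset s <= w} -> `|lim (T s @[s --> refinements t]) - T w| < e.
Proof.
move=> t0 Tcvg e e0; have FF := refinements_filter t0.
have /cvgrPdist_lt/(_ e e0)[s ps Ts] := Tcvg.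
by exists s => // w pw sw; apply: Ts; split.
Qed.

Lemma increasing_transform_cvg t : 0 < t ->
  (forall s u x, 0 <= s -> s <= u -> 0 <= d (F u x - F s x) x) ->
  (forall u, 0 <= u -> exists2 C, 0 <= C & forall x, `|F u x| <= C * `|x|) ->
  cvg (S s @[s --> refinements t]).
Proof.
move=> t0 F_incr F_bounded.
have [C0 C0_ge0 F0C] := F_bounded 0 (lexx 0).
have [Ct Ct_ge0 FtC] := F_bounded t (ltW t0).
(* [Ct + C0] bounds [F t - F 0], whose quadratic form dominates that of every difference of [F]
   between times in [[0, t]]; adding 1 makes the constant positive for the division below. *)
pose C := Ct + C0 + 1; have C_gt0 : 0 < C by rewrite ltr_wpDl ?addr_ge0.
have gap_le r u x : 0 <= r -> r <= u -> u <= t ->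
    d (F u x - F r x) x <= C * `|x| ^+ 2.
  move=> r0 ru ut; have u0 := le_trans r0 ru.
  apply: (@le_trans _ _ (d (F t x - F 0 x) x)).
    rewrite -subr_ge0 -(ipBl dP).
    rewrite (_ : _ - _ = (F t x - F u x) + (F r x - F 0 x)); last first.
      by rewrite opprB addrACA [- F 0 x + _]addrC addrACA.
    by rewrite (ipDl dP) addr_ge0 ?F_incr.
  rewrite -[leLHS]ger0_norm; last exact/F_incr/ltW.
  apply: (le_trans (cauchy_schwarz dP _ _)).
  rewrite expr2 mulrA ler_wpM2r//.
  apply: (le_trans (ler_normB _ _)).
  apply: (le_trans (lerD (FtC x) (F0C x))).
  by rewrite -mulrDl ler_wpM2r// lerDl.
(* Subtracting [F 0] makes every term of the energy nonnegative. *)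
pose Phi := psum (fun p q => d (F p (X q - X p) - F 0 (X q - X p)) (X q - X p)) 0.
have Phi_bound w : itv_partition 0 t w -> 0 <= Phi w <= C * `|X t - X 0| ^+ 2.
  move=> pw; rewrite -(psum_increments pw); move: pw => [p0w /eqP lwt].
  apply: (psum_rel (rel := fun x y => 0 <= x <= C * y) _ _ p0w).
  - by rewrite mulr0 lexx.
  - move=> x y x' y' /andP[x0 xy] /andP[x'0 xy'].
    by rewrite addr_ge0// mulrDr lerD.
  move=> p q p0 pq; rewrite lwt => qt.
  by rewrite F_incr// gap_le// (le_trans (ltW pq)).
(* The energy is complex-valued; its real form allows a supremum in [R]. *)
have Phi_re w : itv_partition 0 t w -> Phi w = (complex.Re (Phi w))%:C.
  by move=> /Phi_bound/andP[Phi0 _]; rewrite RRe_real// ger0_real.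
have S_Phi s w : itv_partition 0 t s -> itv_partition 0 t w -> {subset s <= w} ->
    `|S w - S s| ^+ 2 <= C * (Phi w - Phi s).
  move=> ps pw sw; rewrite (psum_refinementB ps pw sw).
  move: ps pw => [p0s /eqP lst] [p0w /eqP lwt].
  rewrite /Phi -(psum_refine (G := fun c p q =>
    d (F c (X q - X p) - F 0 (X q - X p)) (X q - X p)) _ _ p0s p0w)//.
  - rewrite psumB.
    apply: (psum_rel (rel := fun x y => x <= C * y) _ _ p0w).
    + by rewrite mulr0.
    + by move=> x y x' y' xy xy'; rewrite mulrDr lerD.
    move=> p q p0 pq; rewrite lwt => qt.
    set c := partition_floor 0 s p.
    have c0 : 0 <= c by exact: partition_floor_ge.
    have cp : c <= p by exact: partition_floor_le.
    rewrite -(ipBl dP) opprB addrA subrK.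
    have pt : p <= t by rewrite (le_trans (ltW pq)).
    have [glin _] := commutes_afterB p0 (F_adapted p0)
      (commutes_afterW cp (F_adapted c0)).
    by apply: (positive_norm_le dP glin) => // x; rewrite ?F_incr ?gap_le.
  - move=> c p c0; rewrite subrr; have [Fclin _] := F_adapted c0.
    have [F0lin _] := F_adapted (lexx 0).
    by rewrite (linear0_fun Fclin) (linear0_fun F0lin) subr0 (ip0l dP).
  - move=> c p q r c0 cp pq qr.
    have p0 := le_trans c0 cp.
    apply: (quadratic_increment_additive (K := fun x => F c x - F 0 x) p0
             (ltW pq) qr).
    apply: commutes_afterB => //; first exact: commutes_afterW (F_adapted c0).
    exact: commutes_afterW (F_adapted (lexx 0)).
  - by rewrite lst.
apply: refinements_cauchy_cvg => // e e0.
(* Once the energy of [s] is within [e / C] of the supremum, a refinement can gain less than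
   [e / C]. *)
pose D := [set complex.Re (Phi w) | w in itv_partition 0 t].
have hasD : has_sup D.
  split; first by exists (complex.Re (Phi [:: t])), [:: t] => //; split=> //=;
    rewrite t0.
  exists (complex.Re (C * `|X t - X 0| ^+ 2)) => _ [w pw <-].
  by have /andP[_] := Phi_bound _ pw; rewrite lecE => /andP[].
have eC : 0 < e / C by rewrite divr_gt0.
have eCre : (complex.Re (e / C))%:C = e / C by rewrite RRe_real// gtr0_real.
have eCre0 : 0 < complex.Re (e / C) by rewrite -ltcR eCre.
have [_ [s ps <-] supPhi] := sup_adherent eCre0 hasD.
exists s => // w pw sw; apply: (le_lt_trans (S_Phi s w ps pw sw)).
rewrite mulrC -ltr_pdivlMr// ltrBlDr (Phi_re _ pw) (Phi_re _ ps) -eCre.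
rewrite -rmorphD ltcR -ltrBlDl; apply: le_lt_trans supPhi.
by rewrite lerD2r; apply: ub_le_sup; [case: hasD|exists w].
Qed.

(** Uniform continuity by a supremum argument: among the times [b <= t] up to which a suitable
    partition exists, continuity at the supremum allows one more cell reaching beyond it, unless [t]
    is attained. *)
Lemma floor_close_partition t (eta : R) : 0 < t -> 0 < eta ->
  (forall u e, 0 <= u -> 0 < e -> exists2 delta : R, 0 < delta &
     forall p x, 0 <= p -> `|p - u| < delta -> `|F p x - F u x| <= e%:C * `|x|) ->
  exists2 s, itv_partition 0 t s & forall p x, 0 <= p -> p < t ->
    `|F p x - F (partition_floor 0 s p) x| <= eta%:C * `|x|.
Proof.
move=> t0 eta0 F_cont.
pose good b s := itv_partition 0 b s /\ forall p x, 0 <= p -> p < b ->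
  `|F p x - F (partition_floor 0 s p) x| <= eta%:C * `|x|.
pose D := [set b | b <= t /\ exists s, good b s].
have D0 : D 0.
  split; first exact: ltW.
  (* The empty list partitions the degenerate interval [[0, 0]], where there is no [p] to check. *)
  exists [::]; split; first by split.
  by move=> p x p0; rewrite ltNge p0.
have ubD : has_ubound D by exists t => b [].
have hasD : has_sup D by split; first by exists 0.
have c0 : 0 <= sup D by exact: ub_le_sup.
have eta2 : 0 < eta / 2 by rewrite divr_gt0.
have [delta delta0 Fc] := F_cont _ _ c0 eta2.
have [b [bt [s [[p0s /eqP lsb] gbs]]] cb] := sup_adherent delta0 hasD.
have b0 : 0 <= b by rewrite -lsb path_le_last// mem_head.
have bc : b <= sup D by apply: ub_le_sup => //; split=> //; exists s; split=> //;
  split=> //; rewrite lsb.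
(* Half of [delta] keeps the new cell within the radius of continuity around [sup D]. *)
pose b' := Num.min t (sup D + delta / 2).
have b't : b' <= t by rewrite ge_min lexx.
have b'c : b' <= sup D + delta / 2 by rewrite ge_min lexx orbT.
(* The minimum can fail to exceed [b] only if [b] is already [t]. *)
have [bb'|b'b] := ltP b b'; last first.
  have tb : t <= b.
    move: b'b; rewrite ge_min => /orP[//|cb']; exfalso.
    have := le_trans cb' bc; rewrite gerDl leNgt.
    by rewrite divr_gt0.
  have {tb bt}bt : b = t by apply/eqP; rewrite eq_le bt tb.
  rewrite -bt; exists s => //; split=> //; exact/eqP.
have good' : good b' (rcons s b').
  split.
    by split; rewrite ?last_rcons// -cats1 cat_path p0s lsb/= bb'.
  move=> p x p0 pb'.
  have -> : partition_floor 0 (rcons s b') p = partition_floor 0 s p.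
    by rewrite /partition_floor filter_rcons leNgt pb'.
  have [pb|bp] := ltP p b; first exact: gbs.
  have -> : partition_floor 0 s p = b.
    rewrite /partition_floor -lsb; congr last; apply/all_filterP/allP => y ys.
    apply: le_trans bp; rewrite -lsb path_le_last// inE ys orbT//.
  (* On the new cell both [p] and its floor [b] are within [delta] of [sup D], so each contributes
     half of [eta]. *)
  have close r : b <= r -> r < b' -> `|r - sup D| < delta.
    move=> br rb'; rewrite ltr_norml; apply/andP; split; lra.
  rewrite -(subrKA (F (sup D) x)).
  apply: (le_trans (ler_normD _ _)).
  rewrite [eta]splitr rmorphD mulrDl lerD//; first exact/Fc/close.
  by rewrite distrC; apply/Fc => //; exact: close.
have Db' : D b' by split=> //; exists (rcons s b').
have b'supD : b' <= sup D by exact: ub_le_sup.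
(* As [sup D + delta / 2] exceeds [sup D], the minimum has to be [t]. *)
have b'_t : b' = t.
  move: b'supD; rewrite /b' minEle; case: ifP => // _ h; exfalso; lra.
by case: good'; rewrite b'_t => pt gt; exists (rcons s t).
Qed.

Lemma continuous_transform_cvg t : 0 < t ->
  (forall u e, 0 <= u -> 0 < e -> exists2 delta : R, 0 < delta &
     forall p x, 0 <= p -> `|p - u| < delta -> `|F p x - F u x| <= e%:C * `|x|) ->
  cvg (S s @[s --> refinements t]).
Proof.
move=> t0 F_cont; apply: refinements_cauchy_cvg => // e e0.
have N0 : 0 <= `|X t - X 0| ^+ 2 by exact: exprn_ge0.
pose N := complex.Re (`|X t - X 0| ^+ 2).
have NE : `|X t - X 0| ^+ 2 = N%:C by rewrite RRe_real// ger0_real.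
have eE : e = (complex.Re e)%:C by rewrite RRe_real// gtr0_real.
have Re_e0 : 0 < complex.Re e by rewrite -ltcR -eE.
have {}N0 : 0 <= N by rewrite -lecR -NE.
(* The bound 1 reduces [eta ^+ 2 * N] to at most [eta * N]; the denominator [N + 1] is positive and
   makes the final inequality strict. *)
pose eta := Num.min 1 (complex.Re e / (N + 1)).
have eta0 : 0 < eta by rewrite lt_min ltr01 divr_gt0// ltr_wpDl.
have [s ps gs] := floor_close_partition t0 eta0 F_cont.
exists s => // w pw sw; rewrite (psum_refinementB ps pw sw).
apply: (@le_lt_trans _ _ (eta%:C ^+ 2 * `|X t - X 0| ^+ 2)).
  rewrite -(psum_increments pw); move: pw => [p0w /eqP lwt].
  apply: (psum_rel (rel := fun x y => x <= eta%:C ^+ 2 * y) _ _ p0w).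
  - by rewrite mulr0.
  - by move=> x y x' y' xy xy'; rewrite mulrDr lerD.
  move=> p q p0 pq; rewrite lwt => qt.
  rewrite -exprMn ler_pXn2r ?nnegrE ?mulr_ge0 ?lecR ?(ltW eta0)//.
  by apply: gs => //; exact: lt_le_trans qt.
rewrite NE eE -rmorphXn -rmorphM ltcR.
have eta1 : eta <= 1 by rewrite ge_min lexx.
have etaN : eta * (N + 1) <= complex.Re e.
  by rewrite -ler_pdivlMr ?ltr_wpDl// ge_min lexx orbT.
apply: lt_le_trans etaN; rewrite expr2 -mulrA ltr_pM2l//.
apply: (@le_lt_trans _ _ N); last by rewrite ltrDl.
by rewrite ler_piMl.
Qed.

(** * The martingale property of the limits *)

Let I t := if t == 0 then 0 else lim (S s @[s --> refinements t]).

(** If the two sides were at distance [u > 0], a partition [w] fine enough on both intervals would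
    put [P s (S w)] at distance less than [u / 2] from each of them. *)
Lemma integral_martingale :
  (forall t, 0 < t -> cvg (S s @[s --> refinements t])) ->
  forall s t, 0 <= s -> s <= t -> P s (I t) = I s.
Proof.
move=> Scvg s t s0 st; have t0 := le_trans s0 st.
have [t00|tn0] := eqVneq t 0.
  have -> : s = 0 by apply/eqP; rewrite eq_le s0 andbT -t00.
  by rewrite t00 /I eqxx linear0_fun//; apply: P_linear.
have {}t0 : 0 < t by rewrite lt_neqAle eq_sym tn0.
apply/eqP; rewrite -subr_eq0 -normr_eq0; apply/negPn/negP => u0.
have {}u0 : 0 < `|P s (I t) - I s| by rewrite lt_neqAle eq_sym u0 normr_ge0.
set u := `|_| in u0.
have e0 : 0 < u / 2 by rewrite divr_gt0.
suff [w [Sw1 Sw2]] : exists w, `|I t - S w| < u / 2 /\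
    `|P s (S w) - I s| < u / 2.
  suff : u < u / 2 + u / 2 by rewrite -splitr ltxx.
  apply: le_lt_trans (ltrD Sw1 Sw2).
  rewrite /u -[P s (I t)](subrK (P s (S w))) -addrA.
  apply: (le_trans (ler_normD _ _)); rewrite lerD2r.
  by rewrite -(linearB_fun (P_linear s0)); apply: P_contraction.
have [s1 ps1 Ss1] := refinements_lim t0 (Scvg _ t0) e0.
have It : I t = lim (S s @[s --> refinements t]) by rewrite /I (negPf tn0).
(* At time 0 the whole sum lies in the future and projects to 0, in agreement with the value of [I]
   there. *)
have [s00|sn0] := eqVneq s 0.
  exists s1; rewrite It; split; first exact: Ss1.
  rewrite s00 /I eqxx /S psum_past//; first by rewrite subrr normr0.
  by have [] := ps1.
have {}s0' : 0 < s by rewrite lt_neqAle eq_sym sn0.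
have [s2 ps2 Ss2] := refinements_lim s0' (Scvg _ s0') e0.
(* Inserting [s] itself allows [w] to be cut there; the points of [s2] make its first half fine for
   the integral up to [s]. *)
have [w [pw s1w sw]] : exists w, [/\ itv_partition 0 t w, {subset s1 <= w} &
    {subset s :: s2 <= w}].
  apply: common_refinement => // x; rewrite inE => /orP[/eqP->|].
    by rewrite s0' st.
  have /(itv_partitionP _ s0')[_ + _] := ps2.
  by move=> /[apply] /andP[-> xs]; exact: le_trans st.
exists w; rewrite It; split; first exact: Ss1.
have s_w : s \in w by apply: sw; rewrite mem_head.
case/splitPr: w / s_w => w1 w2 in pw s1w sw *.
move: pw sw => [+ _]; rewrite -cat_rcons cat_path last_rcons => /andP[pw1 pw2] sw.
rewrite /S psum_cat last_rcons (linearD_fun (P_linear s0)).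
rewrite psum_future// ?last_rcons// psum_past// addr0.
rewrite distrC {1}/I (negPf sn0); apply: Ss2.
  by split=> //; rewrite last_rcons.
move=> x xs2; have := sw x; rewrite inE xs2 orbT => /(_ isT).
rewrite mem_cat => /orP[//|xw2].
have /(itv_partitionP _ s0')[_ /(_ x xs2)/andP[_ +] _] := ps2.
by rewrite leNgt (path_gt pw2 xw2).
Qed.

End MartingaleTransforms.

(** * Extension of bounded linear maps from a dense image *)

Section DenseExtension.
Context {R : realType}.

Lemma bounded_linear_cvg (V W : normedModType R[i]) (g : V -> W) C :
  linear g -> 0 <= C -> (forall x, `|g x| <= C * `|x|) -> continuous g.
Proof.
move=> glin C0 gC x; apply/cvgrPdist_lt => e e0.
have C1 : 0 < C + 1 by rewrite ltr_wpDl.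
near=> y; rewrite -linearB_fun//.
apply: (le_lt_trans (gC _)); apply: (@le_lt_trans _ _ ((C + 1) * `|x - y|)).
  by rewrite ler_wpM2r// lerDl.
rewrite mulrC -ltr_pdivlMr//; near: y.
by apply: cvgr_dist_lt; rewrite ?divr_gt0.
Unshelve. all: by end_near. Qed.

Lemma continuous_linear_bound (V : normedModType R[i]) (g : V -> V) :
  linear g -> continuous g ->
  exists2 C, 0 < C & forall x, `|g x| <= C * `|x|.
Proof.
move=> glin gc.
have g0 := linear0_fun glin.
have /cvgrPdist_lt/(_ 1 ltr01)/nbhs_ballP[e /= e0 ge] := gc 0.
exists (2 / e) => [|x]; first by rewrite divr_gt0.
have [->|x0] := eqVneq x 0; first by rewrite g0 !normr0 mulr0.
have nx : 0 < `|x| by rewrite normr_gt0.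
(* Scale [x] to norm [e / 2], inside the ball on which [g] is bounded by 1. *)
have := ge ((e / 2 / `|x|) *: x); rewrite -ball_normE/= g0 !sub0r !normrN.
have k0 : 0 < e / 2 / `|x| by rewrite !divr_gt0.
rewrite (linearZ_fun glin) !normrZ (gtr0_norm k0) divfK ?gt_eqF//.
rewrite ltr_pdivrMr// ltr_pMr// ltr1n => /(_ isT) h.
have -> : `|g x| = 2 / e * `|x| * (e / 2 / `|x| * `|g x|).
  by field; rewrite !gt_eqF.
by rewrite -[leRHS]mulr1 ler_wpM2l ?(ltW h)// mulr_ge0 ?divr_ge0// ltW.
Qed.

Lemma dense_approx (T : Type) (L : normedModType R[i]) (A : set T)
    (iota : T -> L) : dense (iota @` A) ->
  forall (a : L) N, nbhs a N -> exists2 x, A x & N (iota x).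
Proof.
move=> Adense a N aN.
have Na : N^° !=set0 by exists a; exact: nbhs_singleton (nbhs_interior aN).
have [y [Nx [x Ax xE]]] := Adense _ Na (open_interior N).
by rewrite -xE in Nx; exists x => //; exact: interior_subset.
Qed.

Lemma dense_eq (T : Type) (L W : normedModType R[i]) (A : set T)
    (iota : T -> L) (g h : L -> W) : dense (iota @` A) ->
  continuous g -> continuous h -> (forall x, A x -> g (iota x) = h (iota x)) ->
  g =1 h.
Proof.
move=> Adense gc hc gh a; apply/eqP; rewrite -subr_eq0 -normr_eq0.
apply/negPn/negP => n0.
have e0 : 0 < `|g a - h a| / 2 by rewrite divr_gt0// lt_neqAle eq_sym n0/=.
have /cvgrPdist_lt/(_ _ e0) gN := gc a; have /cvgrPdist_lt/(_ _ e0) hN := hc a.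
have [x Ax /= [gx hx]] := dense_approx Adense (filterI gN hN).
suff : `|g a - h a| < `|g a - h a| by rewrite ltxx.
rewrite [ltRHS]splitr; apply: le_lt_trans (ltrD gx hx).
rewrite gh// [X in _ <= _ + X]distrC -(subrKA (h (iota x))).
exact: ler_normD.
Qed.

(** [G] is the closure of the graph sending [iota x] to [h x]. It is linear and bounded, hence
    single-valued; completeness of [W] makes it total, and a choice function for it is the
    extension. *)
Lemma dense_extension (T : lmodType R[i]) (L : normedModType R[i])
    (W : completeNormedModType R[i]) (A : set T) (iota : T -> L) (h : T -> W) C :
  (forall c x y, A x -> A y -> A (c *: x + y)) ->
  (forall c x y, A x -> A y -> iota (c *: x + y) = c *: iota x + iota y) ->
  dense (iota @` A) ->
  (forall c x y, A x -> A y -> h (c *: x + y) = c *: h x + h y) ->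
  0 <= C -> (forall x, A x -> `|h x| <= C * `|iota x|) ->
  exists g : L -> W, [/\ linear g, forall a, `|g a| <= C * `|a| &
    forall x, A x -> g (iota x) = h x].
Proof.
move=> Alin iotalin Adense hlin C0 hC.
have C1 : 0 < C + 1 by rewrite ltr_wpDl.
pose G a b := forall e : R[i], 0 < e ->
  exists x, [/\ A x, `|a - iota x| < e & `|b - h x| < e].
have GL c a b a' b' : G a b -> G a' b' -> G (c *: a + a') (c *: b + b').
  move=> Gab Gab' e e0; pose k := `|c| + 1.
  have k0 : 0 < k by rewrite ltr_wpDl.
  (* The error for [c *: a + a'] is at most [k + 1] times the common error of the two
     approximations. *)
  have e1 : 0 < e / (k + 1) by rewrite divr_gt0// addr_gt0.
  have [x [Ax ax bx]] := Gab _ e1; have [y [Ay ay by']] := Gab' _ e1.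
  have est (Z : normedModType R[i]) (u v u' v' : Z) :
      `|u - v| < e / (k + 1) -> `|u' - v'| < e / (k + 1) ->
      `|c *: u + u' - (c *: v + v')| < e.
    move=> uv uv'; rewrite opprD addrACA -scalerBr.
    apply: (le_lt_trans (ler_normD _ _)); rewrite normrZ.
    have -> : e = k * (e / (k + 1)) + e / (k + 1).
      by rewrite -[X in _ + X]mul1r -mulrDl mulrC divfK// gt_eqF// addr_gt0.
    apply: ler_ltD => //; apply: ler_pM => //; last exact: ltW.
    by rewrite lerDl.
  exists (c *: x + y); split; first exact: Alin.
    by rewrite iotalin//; exact: est.
  by rewrite hlin//; exact: est.
have GC a b : G a b -> `|b| <= C * `|a|.
  move=> Gab; apply/ler_addgt0Pr => e e0.
  have e1 : 0 < e / (C + 1) by rewrite divr_gt0.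
  have [x [Ax ax bx]] := Gab _ e1.
  rewrite -[b](subrK (h x)); apply: (le_trans (ler_normD _ _)).
  rewrite addrC; have -> : e = C * (e / (C + 1)) + e / (C + 1).
    by rewrite -[X in _ + X]mul1r -mulrDl mulrC divfK// gt_eqF.
  rewrite addrA lerD//; last exact: ltW.
  apply: (le_trans (hC _ Ax)); rewrite -mulrDr ler_wpM2l//.
  rewrite -[iota x](subrK a) addrC; apply: (le_trans (ler_normD _ _)).
  by rewrite lerD2l distrC ltW.
have Gx x : A x -> G (iota x) (h x).
  by move=> Ax e e0; exists x; rewrite !subrr !normr0.
have Guniq a b b' : G a b -> G a b' -> b = b'.
  move=> Gab Gab'; have := GC _ _ (GL (-1) _ _ _ _ Gab Gab').
  by rewrite !scaleN1r !addNr normr0 mulr0 normr_le0 addrC subr_eq0 => /eqP.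
have Gtotal a : exists b, G a b.
  (* The filter on [A] of the elements whose images approach [a]; along it [h] is Cauchy by the
     bound [hC]. *)
  pose F := filter_from (nbhs a) (fun N => A `&` (iota @^-1` N)).
  have FF : ProperFilter F.
    apply: filter_from_proper; last first.
      by move=> N /(dense_approx Adense)[x Ax Nx]; exists x.
    apply: filter_from_filter; first by exists setT; exact: filterT.
    move=> N N' aN aN'; exists (N `&` N'); first exact: filterI.
    by move=> x [Ax [Nx N'x]].
  have Fcvg : cvg (h x @[x --> F]).
    apply: cauchy_cvg; apply: cauchy_exP => e e0.
    have e1 : 0 < e / (C + 1) / 2 by rewrite !divr_gt0.
    have aN : nbhs a [set b | `|a - b| < e / (C + 1) / 2].
      by apply/nbhs_ballP; exists (e / (C + 1) / 2) => //= b;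
        rewrite -ball_normE.
    have [x Ax ax] := dense_approx Adense aN.
    exists (h x); exists [set b | `|a - b| < e / (C + 1) / 2] => //.
    move=> y [Ay /= ay]; rewrite -ball_normE/=.
    have -> : h x - h y = h (-1 *: y + x) by rewrite hlin// scaleN1r addrC.
    apply: (le_lt_trans (hC _ (Alin _ _ _ Ay Ax))); rewrite iotalin// scaleN1r.
    apply: (@le_lt_trans _ _ ((C + 1) * `|- iota y + iota x|)).
      by rewrite ler_wpM2r// lerDl.
    rewrite mulrC -ltr_pdivlMr// addrC -(subrKA a) [ltRHS]splitr.
    apply: (le_lt_trans (ler_normD _ _)); apply: ltrD => //.
    by rewrite distrC.
  exists (lim (h x @[x --> F])) => e e0.
  have /cvgrPdist_lt/(_ e e0)[N aN FN] := Fcvg.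
  have aN' : nbhs a (ball a e) by exact: nbhsx_ballx.
  have [x Ax [Nx ax]] := dense_approx Adense (filterI aN aN').
  exists x; split=> //; last exact: FN.
  by move: ax; rewrite -ball_normE.
have [g gG] := choice Gtotal.
exists g; split.
- by move=> c x y; apply: Guniq (gG _) _; apply: GL.
- by move=> a; apply: GC.
- by move=> x Ax; apply: Guniq (gG _) (Gx _ Ax).
Qed.

End DenseExtension.

(** * Bounded operators, von Neumann algebras and traces *)

Section Operators.
Context {R : realType} {H : hilbertType R}.
Implicit Types (x y z : H -> H) (A B : set (H -> H)) (Omega : H).

Lemma dotp_inner_product : inner_product (@dotp R H).
Proof.
split=> [c x y z|x y|x]; last exact: dotp_norm.
  by rewrite linearDl linearZl_LR.
by rewrite [RHS]hermC expr0 mul1r.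
Qed.
Let dP := dotp_inner_product.

Lemma norm_dotp_eq (x y : H) : dotp x x = dotp y y -> `|x| = `|y|.
Proof.
rewrite -!dotp_norm => xy.
by apply/eqP; rewrite -(eqrXn2 (n := 2) _ (normr_ge0 x) (normr_ge0 y))// xy.
Qed.

Lemma Re_norm (x : H) : `|x| = (complex.Re `|x|)%:C.
Proof. by rewrite RRe_real// ger0_real. Qed.

Lemma opnorm_ubound x : bounded_op x ->
  has_ubound [set complex.Re `|x xi| | xi in [set xi : H | `|xi| <= 1]].
Proof.
move=> [xlin xc]; have [C C0 xC] := continuous_linear_bound xlin xc.
exists (complex.Re C) => _ [xi /= xi1 <-].
have : `|x xi| <= C by rewrite (le_trans (xC xi))// ler_piMr// ltW.
by rewrite lecE => /andP[].
Qed.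

Lemma opnorm_ge0 x : bounded_op x -> 0 <= opnorm x.
Proof.
move=> xb; have [xlin _] := xb; apply: ub_le_sup; first exact: opnorm_ubound.
by exists 0; rewrite /= ?normr0 ?(linear0_fun xlin) ?normr0.
Qed.

Lemma opnormP x : bounded_op x -> forall xi, `|x xi| <= (opnorm x)%:C * `|xi|.
Proof.
move=> xb xi; have [xlin _] := xb.
have [->|xi0] := eqVneq xi 0; first by rewrite (linear0_fun xlin) !normr0 mulr0.
have nxi : 0 < `|xi| by rewrite normr_gt0.
rewrite -ler_pdivrMr// mulrC.
have -> : `|xi|^-1 * `|x xi| = `|x (`|xi|^-1 *: xi)|.
  by rewrite (linearZ_fun xlin) normrZ gtr0_norm ?invr_gt0.
rewrite Re_norm lecR; apply: ub_le_sup; first exact: opnorm_ubound.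
exists (`|xi|^-1 *: xi) => //=.
by rewrite normrZ gtr0_norm ?invr_gt0// mulVf// gt_eqF.
Qed.

Lemma adjoint_of_sym x y : adjoint_of x y -> adjoint_of y x.
Proof. by move=> xy xi eta; rewrite -(ip_conj dP) -xy (ip_conj dP). Qed.

(** The square of the norm of [y xi] is [dotp (x (y xi)) xi], to which the Cauchy-Schwarz inequality
    applies. *)
Lemma opnorm_adjoint x y : bounded_op x -> adjoint_of x y ->
  forall xi, `|y xi| <= (opnorm x)%:C * `|xi|.
Proof.
move=> xb xy xi; have [->|y0] := eqVneq (y xi) 0.
  by rewrite normr0 mulr_ge0// lecR opnorm_ge0.
have ny : 0 < `|y xi| by rewrite normr_gt0.
rewrite -(ler_pM2l ny) -expr2 dotp_norm -xy.
rewrite -[leLHS]ger0_norm; last by rewrite xy (ip_ge0 dP).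
apply: (le_trans (cauchy_schwarz dP _ _)).
by rewrite mulrA ler_wpM2r// mulrC opnormP.
Qed.

Lemma bounded_op_id : bounded_op (id : H -> H).
Proof. by split=> // x; exact: cvg_id. Qed.

Lemma bounded_op_comp x y : bounded_op x -> bounded_op y -> bounded_op (x \o y).
Proof.
move=> [xlin xc] [ylin yc]; split=> [c u v /=|u].
  by rewrite ylin xlin.
by apply: continuous_comp; [exact: yc|exact: xc].
Qed.

Lemma bounded_op_linear c x y :
  bounded_op x -> bounded_op y -> bounded_op (c *: x + y).
Proof.
move=> [xlin xc] [ylin yc]; split=> [a u v|u].
  rewrite !fctE xlin ylin !scalerDr !scalerA mulrC -!addrA; congr (_ + _).
  by rewrite addrCA.
apply: cvgD; last exact: yc.
by apply: cvgZr; exact: xc.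
Qed.

Lemma von_neumann_comp A x y : von_neumann A -> A x -> A y -> A (x \o y).
Proof.
move=> vA; rewrite -(von_neumann_bicommutant vA) => -[xb xC] [yb yC].
split; first exact: bounded_op_comp.
move=> z Cz; have xz := xC z Cz; have yz := yC z Cz.
rewrite -[LHS]/(x \o (y \o z)) yz -[LHS]/((x \o z) \o y) xz.
done.
Qed.

Lemma von_neumann_id A : von_neumann A -> A id.
Proof.
move=> vA; rewrite -(von_neumann_bicommutant vA).
by split; first exact: bounded_op_id.
Qed.

Lemma von_neumann_linear A c x y : von_neumann A -> A x -> A y ->
  A (c *: x + y).
Proof.
move=> vA; rewrite -(von_neumann_bicommutant vA) => -[xb xC] [yb yC].
split; first exact: bounded_op_linear.
move=> z Cz; have [[zlin _] _] := Cz; apply/funext => u /=.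
rewrite !fctE zlin.
have /(congr1 (fun g => g u))/= <- := xC z Cz.
by have /(congr1 (fun g => g u))/= <- := yC z Cz.
Qed.

(** By traciality an element and its adjoint have equal [norm2]. So [y \o x] may be replaced by its
    adjoint [x' \o y'], in which [x'] acts on the vector [y' Omega]. *)
Lemma tracial_rmul_norm A Omega x y : von_neumann A -> tracial A Omega ->
  A x -> A y -> norm2 Omega (y \o x) <= (opnorm x)%:C * norm2 Omega y.
Proof.
move=> vA tr Ax Ay; have xb := von_neumann_bounded vA Ax.
have [x' Ax' xx'] := von_neumann_star vA Ax.
have [y' Ay' yy'] := von_neumann_star vA Ay.
have Acomp := von_neumann_comp vA.
have yE : norm2 Omega y' = norm2 Omega y.
  apply: norm_dotp_eq; have := tr _ _ Ay Ay'; rewrite /vector_state/= yy' => ->.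
  by rewrite (adjoint_of_sym yy').
have -> : norm2 Omega (y \o x) = `|x' (y' Omega)|.
  apply: norm_dotp_eq; rewrite /= -xx'.
  rewrite -(adjoint_of_sym yy') -(adjoint_of_sym xx').
  have := tr _ _ (Acomp _ _ Ax' Ay') (Acomp _ _ Ay Ax).
  by rewrite /vector_state /= => ->; rewrite yy'.
by rewrite -yE; exact: opnorm_adjoint.
Qed.

(** Cycling [y' \o y \o x] to [y \o x \o y'] under the trace gives
    [dotp (x (y' Omega)) (y' Omega)]. *)
Lemma tracial_rmul_ge0 A Omega x y : von_neumann A -> tracial A Omega ->
  A x -> A y -> op_ge0 x -> 0 <= dotp ((y \o x) Omega) (y Omega).
Proof.
move=> vA tr Ax Ay x0; have Acomp := von_neumann_comp vA.
have [y' Ay' yy'] := von_neumann_star vA Ay.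
rewrite -(adjoint_of_sym yy').
have := tr _ _ Ay' (Acomp _ _ Ay Ax); rewrite /vector_state /= => ->.
by rewrite yy'.
Qed.

(** * Conditional expectations as orthogonal projections *)

Section ConditionalExpectation.
Variables (A B : set (H -> H)) (Omega : H) (E : (H -> H) -> H -> H).
Hypotheses (vA : von_neumann A) (vB : von_neumann B) (BA : B `<=` A).
Hypotheses (EP : conditional_expectation A B E) (Einv : state_invariant A Omega E).

Lemma cond_exp_lmul x y : B x -> A y -> E (x \o y) = x \o E y.
Proof.
by move=> Bx Ay; have := cond_exp_bimodule EP Bx Ay (von_neumann_id vB).
Qed.

Lemma cond_exp_rmul x y : B x -> A y -> E (y \o x) = E y \o x.
Proof.
by move=> Bx Ay; have := cond_exp_bimodule EP (von_neumann_id vB) Ay Bx.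
Qed.

(** The state takes the same value at [y' \o E x = E (y' \o x)] and at [y' \o x], by invariance. *)
Lemma cond_exp_orthogonal x y : A x -> B y ->
  dotp (E x Omega) (y Omega) = dotp (x Omega) (y Omega).
Proof.
move=> Ax By; have [y' By' yy'] := von_neumann_star vB By.
rewrite -!(adjoint_of_sym yy').
have := Einv (von_neumann_comp vA (BA By') Ax).
by rewrite cond_exp_lmul.
Qed.

(** Both sides equal [dotp (E x Omega) (E y Omega)]. *)
Lemma cond_exp_symmetric x y : A x -> A y ->
  dotp (E x Omega) (y Omega) = dotp (x Omega) (E y Omega).
Proof.
move=> Ax Ay; have Ex := cond_exp_in EP Ax; have Ey := cond_exp_in EP Ay.
by rewrite -(cond_exp_orthogonal Ax Ey) -!(ip_conj dP (E x Omega))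
  cond_exp_orthogonal.
Qed.

Lemma cond_exp_norm x : A x -> norm2 Omega (E x) <= norm2 Omega x.
Proof.
move=> Ax; have Ex := cond_exp_in EP Ax.
rewrite /norm2 -(@ler_pXn2r _ 2) ?nnegrE//.
rewrite -[x Omega in leRHS](subrK (E x Omega)) (ip_pythagoras dP).
  by rewrite lerDr exprn_ge0.
by rewrite (ipBl dP) cond_exp_orthogonal// subrr.
Qed.

End ConditionalExpectation.

End Operators.

(** * The completion and the operators induced on it *)

Section NoncommutativeL2.
Context {R : realType} {H : hilbertType R}.
Variables (A : set (H -> H)) (Omega : H).
Variables (L2 : completeNormedModType R[i]) (iota : (H -> H) -> L2).
Hypotheses (vA : von_neumann A) (L2P : completion2 A Omega iota).

Let Adense := completion2_dense L2P.
Let Alin c x y := @von_neumann_linear R H A c x y vA.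
Let iotalin := completion2_linear L2P.
Let dotpP := @dotp_inner_product R H.

Lemma extend2E T (g : L2 -> L2) : continuous g ->
  (forall y, A y -> g (iota y) = iota (T y)) -> extend2 A iota T = g.
Proof.
move=> gc gT; rewrite /extend2; set S := [set _ | _].
have [ec eT] : S (xget (cst 0) S) by apply: xgetPex; exists g.
apply/funext; apply: (dense_eq Adense) => // x Ax.
by rewrite eT ?gT.
Qed.

Lemma extend2P T C : (forall y, A y -> A (T y)) ->
  (forall c x y, A x -> A y -> T (c *: x + y) = c *: T x + T y) ->
  0 <= C -> (forall y, A y -> norm2 Omega (T y) <= C * norm2 Omega y) ->
  [/\ linear (extend2 A iota T), continuous (extend2 A iota T),
      forall a, `|extend2 A iota T a| <= C * `|a| &
      forall y, A y -> extend2 A iota T (iota y) = iota (T y)].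
Proof.
move=> AT Tlin C0 TC.
pose h := iota \o T.
have hlin c x y : A x -> A y -> h (c *: x + y) = c *: h x + h y.
  by move=> Ax Ay; rewrite /h/= Tlin// iotalin//; exact: AT.
have hC x : A x -> `|h x| <= C * `|iota x|.
  by move=> Ax; rewrite !(completion2_norm L2P) ?TC//; exact: AT.
have [g [glin gC gT]] := dense_extension Alin iotalin Adense hlin C0 hC.
have gc := bounded_linear_cvg glin C0 gC.
by rewrite (extend2E gc gT); split.
Qed.

(** The completion comes only with a norm; this isometry carries the inner product of [H] over to
    it. *)
Lemma L2_isometry : exists U : L2 -> H, [/\ linear U,
  forall a, `|U a| = `|a| & forall x, A x -> U (iota x) = x Omega].
Proof.
pose h (x : H -> H) := x Omega.
have hlin c x y : A x -> A y -> h (c *: x + y) = c *: h x + h y by [].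
have h1 x : A x -> `|h x| <= 1 * `|iota x|.
  by move=> Ax; rewrite (completion2_norm L2P)// mul1r.
have [U [Ulin UC Uiota]] := dense_extension Alin iotalin Adense hlin ler01 h1.
have Uc := bounded_linear_cvg Ulin ler01 UC.
exists U; split=> // a.
pose K := (R[i] : numFieldType).
apply: (dense_eq (W := K^o) Adense (g := fun a => `|U a| : K)
         (h := fun a => `|a| : K)) => [b|b|x Ax].
- by apply: cvg_norm; exact: Uc.
- by apply: cvg_norm; exact: cvg_id.
- by rewrite Uiota// (completion2_norm L2P).
Qed.

Section Isometry.
Variable U : L2 -> H.
Hypotheses (U_linear : linear U) (U_norm : forall a, `|U a| = `|a|).
Hypothesis U_iota : forall x, A x -> U (iota x) = x Omega.

Definition L2_dot (a b : L2) : R[i] := dotp (U a) (U b).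

Lemma L2_dot_inner_product : inner_product L2_dot.
Proof.
split=> [c x y z|x y|x]; rewrite /L2_dot.
- by rewrite U_linear (ip_linear dotpP).
- exact: (ip_conj dotpP).
- by rewrite -U_norm (ip_norm dotpP).
Qed.
Let dP := L2_dot_inner_product.

Lemma L2_dot_continuous (g h : L2 -> L2) : continuous g -> continuous h ->
  continuous (fun a => L2_dot (g a) (h a) : (R[i] : numFieldType)).
Proof. exact: ip_continuous. Qed.

(** * Projections induced by the conditional expectations *)

Variables (At : R -> set (H -> H)) (E : R -> (H -> H) -> H -> H).
Hypotheses (At_filtration : filtration A At).
Hypothesis E_cond_exp :
  forall t : R, 0 <= t -> conditional_expectation A (At t) (E t).
Hypothesis E_invariant : forall t : R, 0 <= t -> state_invariant A Omega (E t).

Let vAt := filtration_von_neumann At_filtration.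
Let AtA := filtration_sub At_filtration.
Let P t := extend2 A iota (E t).

Lemma cond_exp_in_algebra t x : 0 <= t -> A x -> A (E t x).
Proof. by move=> t0 Ax; apply: (AtA t0); exact: (cond_exp_in (E_cond_exp t0)). Qed.

Lemma extend2_cond_exp t : 0 <= t -> [/\ linear (P t), continuous (P t),
  forall a, `|P t a| <= `|a| & forall y, A y -> P t (iota y) = iota (E t y)].
Proof.
move=> t0; have E1 y : A y -> norm2 Omega (E t y) <= 1 * norm2 Omega y.
  by rewrite mul1r; exact: (cond_exp_norm vA (vAt t0) (AtA t0) (E_cond_exp t0)
    (E_invariant t0)).
have [Plin Pc PC Piota] := extend2P (fun y => cond_exp_in_algebra t0 (x := y))
  (cond_exp_linear (E_cond_exp t0)) ler01 E1.
by split=> // a; rewrite (le_trans (PC a))// mul1r.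
Qed.

Lemma extend2_cond_exp_symmetric t : 0 <= t ->
  forall a b, L2_dot (P t a) b = L2_dot a (P t b).
Proof.
move=> t0; have [_ Pc _ Piota] := extend2_cond_exp t0.
have idc : continuous (id : L2 -> L2) by move=> x; exact: cvg_id.
have cstc b : continuous (fun _ : L2 => b : L2) by move=> x; exact: cvg_cst.
pose K := (R[i] : numFieldType).
move=> a b; move: b.
apply: (dense_eq (W := K^o) Adense (L2_dot_continuous (cstc (P t a)) idc)
         (L2_dot_continuous (cstc a) Pc)) => y Ay; move: a.
apply: (dense_eq (W := K^o) Adense (L2_dot_continuous Pc (cstc (iota y)))
         (L2_dot_continuous idc (cstc (P t (iota y))))) => x Ax.
rewrite /L2_dot !Piota// !U_iota//; try exact: cond_exp_in_algebra.
exact: (cond_exp_symmetric vA (vAt t0) (AtA t0) (E_cond_exp t0) (E_invariant t0)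
  Ax Ay).
Qed.

Lemma extend2_cond_exp_id s t : 0 <= s -> s <= t ->
  forall a, P t (P s a) = P s a.
Proof.
move=> s0 st; have t0 := le_trans s0 st.
have [_ Psc _ Ps] := extend2_cond_exp s0.
have [_ Ptc _ Pt] := extend2_cond_exp t0.
apply: (dense_eq Adense _ Psc) => [a|x Ax].
  by apply: continuous_comp; [exact: Psc|exact: Ptc].
rewrite Ps// Pt; last exact: cond_exp_in_algebra.
rewrite (cond_exp_id (E_cond_exp t0))//.
apply: (filtration_increasing At_filtration s0 st).
exact: (cond_exp_in (E_cond_exp s0)).
Qed.

(** The adjoint of the relation in [extend2_cond_exp_id]. *)
Lemma extend2_cond_exp_tower s t : 0 <= s -> s <= t ->
  forall a, P s (P t a) = P s a.
Proof.
move=> s0 st a; have t0 := le_trans s0 st.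
apply: (ip_injl dP) => b.
by rewrite !extend2_cond_exp_symmetric// extend2_cond_exp_id.
Qed.

(** * Left and right multiplication, treated at once as [mul] *)

Variable mul : (H -> H) -> (H -> H) -> H -> H.
Hypothesis mul_in : forall x y, A x -> A y -> A (mul x y).
Hypothesis mul_linl : forall c x y z, A x -> A y -> A z ->
  mul (c *: x + y) z = c *: mul x z + mul y z.
Hypothesis mul_linr : forall c x y z, A x -> A y -> A z ->
  mul x (c *: y + z) = c *: mul x y + mul x z.
Hypothesis mul_norm : forall x y, A x -> A y ->
  norm2 Omega (mul x y) <= (opnorm x)%:C * norm2 Omega y.
Hypothesis mul_ge0 : forall x y, A x -> A y -> op_ge0 x ->
  0 <= dotp (mul x y Omega) (y Omega).
Hypothesis mul_cond_exp : forall u x y, 0 <= u -> At u x -> A y ->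
  E u (mul x y) = mul x (E u y).

Let M x := extend2 A iota (mul x).

Lemma extend2_mul x : A x -> [/\ linear (M x), continuous (M x),
  forall a, `|M x a| <= (opnorm x)%:C * `|a| &
  forall y, A y -> M x (iota y) = iota (mul x y)].
Proof.
move=> Ax; apply: extend2P.
- by move=> y; exact: mul_in.
- by move=> c y z; exact: mul_linr.
- by rewrite lecR; apply/opnorm_ge0/(von_neumann_bounded vA).
- by move=> y; exact: mul_norm.
Qed.

Lemma extend2_mulB x y a : A x -> A y -> M (x - y) a = M x a - M y a.
Proof.
move=> Ax Ay; have xyE : x - y = -1 *: y + x by rewrite scaleN1r addrC.
have Axy : A (x - y) by rewrite xyE; exact: Alin.
have [_ xyc _ Mxy] := extend2_mul Axy; have [_ xc _ Mx] := extend2_mul Ax.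
have [_ yc _ My] := extend2_mul Ay.
move: a; apply: (dense_eq Adense) => // [a|z Az].
  by apply: cvgB; [exact: xc|exact: yc].
rewrite Mxy// Mx// My// xyE mul_linl//.
rewrite iotalin; [|exact: mul_in..].
by rewrite scaleN1r addrC.
Qed.

Lemma extend2_mul_ge0 x : A x -> op_ge0 x -> forall a, 0 <= L2_dot (M x a) a.
Proof.
(* Nonnegativity becomes the equality of a value with its modulus, and equalities of continuous
   functions extend from the dense image. *)
move=> Ax x0 a; apply/normr_idP; move: a.
have [_ xc _ Mx] := extend2_mul Ax.
have idc : continuous (id : L2 -> L2) by move=> b; exact: cvg_id.
have dc := L2_dot_continuous xc idc.
pose K := (R[i] : numFieldType).
have nc : continuous (fun a => `|L2_dot (M x a) a| : K).
  by move=> a; exact: (@cvg_norm K K^o _ _ _ _ _ (dc a)).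
apply: (dense_eq (W := K^o) Adense nc dc) => y Ay.
rewrite ger0_norm// Mx// /L2_dot !U_iota//; last exact: mul_in.
exact: mul_ge0.
Qed.

Lemma extend2_mul_comm u x : 0 <= u -> At u x ->
  forall a, P u (M x a) = M x (P u a).
Proof.
move=> u0 Atx; have Ax := AtA u0 Atx.
have [_ xc _ Mx] := extend2_mul Ax; have [_ Pc _ Pu] := extend2_cond_exp u0.
apply: (dense_eq Adense) => [a|a|y Ay].
- by apply: continuous_comp; [exact: xc|exact: Pc].
- by apply: continuous_comp; [exact: Pc|exact: xc].
rewrite Mx// !Pu//; last exact: mul_in.
by rewrite mul_cond_exp// Mx//; exact: cond_exp_in_algebra.
Qed.

(** * Integral sums of an adapted process *)

Variables (X : R -> L2) (f : R -> H -> H).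
Hypothesis X_martingale : martingale A iota E X.
Hypothesis f_adapted : adapted At f.
Hypothesis f_regular : monotone_process f \/ opnorm_continuous f.

Let S s := psum (fun p q => M (f p) (X q - X p)) 0 s.

Let f_in_A t : 0 <= t -> A (f t).
Proof. by move=> t0; apply: (AtA t0); exact: f_adapted. Qed.

Let F_adapted p : 0 <= p -> commutes_after P p (M (f p)).
Proof.
move=> p0; split; first by have [] := extend2_mul (f_in_A p0).
move=> u x pu; apply: extend2_mul_comm; first exact: le_trans pu.
by apply: (filtration_increasing At_filtration p0 pu); exact: f_adapted.
Qed.

Let F_bounded u : 0 <= u ->
  exists2 C, 0 <= C & forall x, `|M (f u) x| <= C * `|x|.
Proof.
move=> u0; have [_ _ fC _] := extend2_mul (f_in_A u0).
exists (opnorm (f u))%:C => //.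
by rewrite lecR; apply/opnorm_ge0/(von_neumann_bounded vA)/f_in_A.
Qed.

Let P_linear t (t0 : 0 <= t) : linear (P t).
Proof. by have [] := extend2_cond_exp t0. Qed.

Let P_contraction t (t0 : 0 <= t) x : `|P t x| <= `|x|.
Proof. by have [_ _ + _] := extend2_cond_exp t0; exact. Qed.

Let M_incr x y a : A x -> A y -> op_le x y -> 0 <= L2_dot (M y a - M x a) a.
Proof.
move=> Ax Ay xy; rewrite -extend2_mulB//; apply: extend2_mul_ge0 => //.
by rewrite addrC -scaleN1r; exact: Alin.
Qed.

Lemma martingale_sums_cvg t : 0 < t -> cvg (S s @[s --> refinements t]).
Proof.
move=> t0; case: f_regular => [[f_incr|f_decr]|f_cont].
- apply: (increasing_transform_cvg dP P_linear extend2_cond_exp_symmetric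
    extend2_cond_exp_tower extend2_cond_exp_id X_martingale F_adapted t0) => //.
  move=> s u x s0 su; have u0 := le_trans s0 su.
  by apply: M_incr; [exact: f_in_A..|exact: f_incr].
(* The decreasing case is the increasing one for the opposite operators; the sums only change
   sign. *)
- have Fadap p : 0 <= p -> commutes_after P p (fun x => - M (f p) x).
    by move=> p0; apply: commutes_afterN; [exact: P_linear|by []|exact: F_adapted].
  have Scvg := increasing_transform_cvg dP P_linear extend2_cond_exp_symmetric
    extend2_cond_exp_tower extend2_cond_exp_id X_martingale Fadap t0.
  have -> : S = fun s => - psum (fun p q => - M (f p) (X q - X p)) 0 s.
    by apply/funext => s; rewrite psumN opprK.
  have FF := refinements_filter t0.
  apply: is_cvgN; apply: Scvg => [s u x s0 su|u u0].
    have u0 := le_trans s0 su.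
    by rewrite opprK addrC; apply: M_incr; [exact: f_in_A..|exact: f_decr].
  have [C C0 FC] := F_bounded u0.
  by exists C => // x; rewrite normrN.
- apply: (continuous_transform_cvg dP P_linear extend2_cond_exp_symmetric
    extend2_cond_exp_tower extend2_cond_exp_id X_martingale F_adapted t0).
  move=> u e u0 e0; have /cvgrPdist_lt/(_ _ e0) := f_cont u u0.
  move=> /nbhs_ballP[delta /= delta0 fdelta].
  exists delta => // p x p0 pu.
  have := fdelta p; rewrite -ball_normE/= distrC => /(_ pu p0).
  have Apu : A (f p - f u).
    by rewrite addrC -scaleN1r; apply: Alin; exact: f_in_A.
  rewrite sub0r normrN ger0_norm; last first.
    by apply/opnorm_ge0/(von_neumann_bounded vA).
  move=> fpu; rewrite -extend2_mulB; [|exact: f_in_A..].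
  have [_ _ Mpu _] := extend2_mul Apu.
  by apply: (le_trans (Mpu x)); rewrite ler_wpM2r// lecR ltW.
Qed.

(** The sums are spelled with [nth] so that the two choices of [mul] make them convertible to
    [sum_fdX] and [sum_dXf]. *)
Lemma martingale_integral :
  let t_ s := nth 0 (0 :: s) in
  let T s := \sum_(0 <= k < size s)
    extend2 A iota (mul (f (t_ s k))) (X (t_ s k.+1) - X (t_ s k)) in
  (forall t, 0 < t -> cvg (T s @[s --> refinements t])) /\
  martingale A iota E
    (fun t => if t == 0 then 0 else lim (T s @[s --> refinements t])).
Proof.
move=> t_ T; have -> : T = S by apply/funext => s; rewrite /S psum_nth.
split; first exact: martingale_sums_cvg.
move=> s t s0 st.
exact: (integral_martingale P_linear P_contraction extend2_cond_exp_tower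
  extend2_cond_exp_id X_martingale F_adapted martingale_sums_cvg s0 st).
Qed.

End Isometry.
End NoncommutativeL2.

Unset Implicit Arguments.

Theorem theorem3 (R : realType) (H : hilbertType R)
    (A : set (H -> H)) (Omega : H)
    (At : R -> set (H -> H)) (E : R -> (H -> H) -> H -> H)
    (L2 : completeNormedModType R[i]) (iota : (H -> H) -> L2)
    (X : R -> L2) (f : R -> H -> H)
    (A_vN : von_neumann A)
    (Omega_unit : `|Omega| = 1)
    (Omega_cyclic : cyclic_vector A Omega)
    (Omega_separating : separating_vector A Omega)
    (At_filtration : filtration A At)
    (E_cond_exp : forall t : R, 0 <= t -> conditional_expectation A (At t) (E t))
    (E_normal : forall t : R, 0 <= t -> normal_map A (At t) (E t))
    (E_invariant : forall t : R, 0 <= t -> state_invariant A Omega (E t))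
    (L2_completion : completion2 A Omega iota)
    (omega_tracial : tracial A Omega)
    (X_martingale : martingale A iota E X)
    (f_in_A : forall t : R, 0 <= t -> A (f t))
    (f_adapted : adapted At f)
    (f_regular : monotone_process f \/ opnorm_continuous f) :
  (forall t : R, 0 < t ->
     cvg (sum_fdX A iota f X s @[s --> refinements t]) /\
     cvg (sum_dXf A iota f X s @[s --> refinements t])) /\
  martingale A iota E (integral_dXf A iota f X) /\
  martingale A iota E (integral_fdX A iota f X).
Proof.
have [U [U_lin U_norm U_iota]] := L2_isometry A_vN L2_completion.
have lbounded x : A x -> bounded_op x by exact: von_neumann_bounded.
(* For left multiplication, the norm bound and positivity are those of the operator [x] at the
   vector [y Omega]. *)
have [cvg_l mart_l] : (forall t : R, 0 < t ->
    cvg (sum_fdX A iota f X s @[s --> refinements t])) /\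
  martingale A iota E (integral_fdX A iota f X).
  apply: (martingale_integral A_vN L2_completion U_lin U_norm U_iota
    At_filtration E_cond_exp E_invariant (mul := fun x y => x \o y)) => //.
  - by move=> x y; exact: von_neumann_comp.
  - move=> c x y z Ax _ _; apply/funext => u.
    by have [xlin _] := lbounded x Ax; exact: (xlin c (y u) (z u)).
  - by move=> x y Ax _; exact/opnormP/lbounded.
  - by move=> x y _ _; exact.
  - move=> u x y u0; exact: (cond_exp_lmul
      (filtration_von_neumann At_filtration u0) (E_cond_exp u u0)).
(* For right multiplication, the norm bound and positivity come from traciality. *)
have [cvg_r mart_r] : (forall t : R, 0 < t ->
    cvg (sum_dXf A iota f X s @[s --> refinements t])) /\
  martingale A iota E (integral_dXf A iota f X).
  apply: (martingale_integral A_vN L2_completion U_lin U_norm U_iota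
    At_filtration E_cond_exp E_invariant (mul := fun x y => y \o x)) => //.
  - by move=> x y Ax Ay; exact: von_neumann_comp.
  - move=> c x y z _ _ Az; apply/funext => u.
    by have [zlin _] := lbounded z Az; exact: (zlin c (x u) (y u)).
  - by move=> x y; exact: tracial_rmul_norm.
  - by move=> x y; exact: tracial_rmul_ge0.
  - move=> u x y u0; exact: (cond_exp_rmul
      (filtration_von_neumann At_filtration u0) (E_cond_exp u u0)).
by split=> [t t0|]; [split; [exact: cvg_l|exact: cvg_r]|split].
Qed.
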